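(* There is a polynomial time algorithm that, given a shifted matrix $c\in\mathbb{Z}^{d\times n}$ (that is, each row of $c$ is nonincreasing) and an independence system $S\subseteq\{0,1\}^d$ presented by a linear optimization oracle, finds $y\in S^n$ with $$c\,\overline{y}\ \geq\ \beta\cdot\max\{c\,\overline{z}\ :\ z\in S^n\},\qquad \beta = 1-\left(1-\frac 1n\right)^n \geq 1-\frac 1e\ \geq\ 0.6321 .$$
   Context: For a matrix $x$, $x_i$ denotes its $i$-th row and $x^j$ its $j$-th column. For $S\subseteq\{0,1\}^d$, $S^n$ is the set of $d\times n$ matrices all of whose columns lie in $S$. The shift $\overline{x}$ of $x\in\mathbb{R}^{d\times n}$ is the unique matrix obtained from $x$ by permuting the entries within each row so that each row is nonincreasing. A matrix $x$ is shifted if $x=\overline{x}$. For $c,x\in\mathbb{R}^{d\times n}$, $cx:=\sum_{i,j}c_{i,j}x_{i,j}$. A set $S\subseteq\{0,1\}^d$ is an independence system (downward monotone) if $0\in S$ and whenever $u\in\{0,1\}^d$ and $u\le v\in S$ then $u\in S$. A linear optimization oracle for $S$ is an oracle that, queried on $w\in\mathbb{Z}^d$, returns $s\in S$ maximizing $ws=\sum_i w_is_i$ over $S$. An algorithm is polynomial time if its running time, including the number of calls to the oracle presenting $S$, is polynomial. *)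

(* Defs.v *)
From mathcomp Require Import all_boot all_order all_algebra all_fingroup.

Set Implicit Arguments.
Unset Strict Implicit.
Unset Printing Implicit Defensive.

Import Order.TTheory GRing.Theory Num.Theory.
Local Open Scope ring_scope.

Section Shift.
Variables (R : realDomainType) (d n : nat).
Implicit Types c x y : 'M[R]_(d, n).

Definition row_nonincreasing x : Prop :=
  forall (i : 'I_d) (j k : 'I_n), (j <= k)%N -> x i k <= x i j.

Definition shift x : 'M[R]_(d, n) :=
  \matrix_(i, j) (sort >=%R [seq x i k | k <- enum 'I_n])`_j.

Definition shifted x : Prop := x = shift x.

Definition pairing c x : R := \sum_i \sum_j c i j * x i j.

(* [shift x] is the unique matrix with nonincreasing rows that is obtained
   from [x] by permuting the entries within each row. *)
Lemma shiftP x y :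
  y = shift x <->
  (forall i, exists s : {perm 'I_n}, forall j, y i j = x i (s j)) /\
  row_nonincreasing y.
Proof.
have szs i : size (sort >=%R [seq x i k | k <- enum 'I_n]) = n.
  by rewrite size_sort size_map size_enum_ord.
have getr : transitive (>=%R : rel R) by move=> a b c /= ab bc; apply: le_trans ab.
have geto : total (>=%R : rel R) by move=> a b; apply: (le_total b a).
have gean : antisymmetric (>=%R : rel R).
  by move=> a b /= ba; apply/eqP; rewrite eq_le andbC.
have rowE (f : 'I_n -> R) (k : 'I_n) : [seq f l | l <- enum 'I_n]`_k = f k.
  by rewrite (nth_map k) ?size_enum_ord ?nth_ord_enum.
split=> [-> | [perm_y sort_y]].
  split=> [i | i j k le_jk]; last first.
    rewrite !mxE; apply: (sorted_leq_nth getr) => //; rewrite ?inE ?szs //.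
    - exact: lexx.
    - exact: (sort_sorted geto).
  have szT : size (sort >=%R [seq x i k | k <- enum 'I_n]) == n by rewrite szs.
  have szT' : size [seq x i k | k <- enum 'I_n] == n.
    by rewrite size_map size_enum_ord.
  have /tuple_permP[s Es] : perm_eq (Tuple szT) (Tuple szT').
    by rewrite /= perm_sort.
  exists s => j; rewrite mxE /= in Es *.
  rewrite Es (nth_map j) ?size_enum_ord // nth_ord_enum.
  by rewrite (tnth_nth 0) /= rowE.
apply/matrixP=> i j; rewrite mxE -[LHS](rowE (y i)).
congr (_`_j); apply: (sorted_eq getr gean); last 1 first.
- rewrite perm_sym perm_sort perm_sym; have [s Es] := perm_y i.
  rewrite (eq_map Es) (map_comp (x i)) perm_map //; apply: uniq_perm.
  + by rewrite map_inj_uniq ?enum_uniq //; apply: perm_inj.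
  + exact: enum_uniq.
  move=> k; rewrite mem_enum; apply/mapP; exists (s^-1%g k).
    by rewrite mem_enum.
  by rewrite permKV.
- have [n0 | n_gt0] := posnP n.
    by rewrite (size0nil (s := map _ _)) // size_map size_enum_ord.
  apply/(sortedP 0) => k; rewrite size_map size_enum_ord => ltk.
  rewrite -[k]/(val (Ordinal (ltnW ltk))) -[k.+1]/(val (Ordinal ltk)) !rowE.
  exact/sort_y/leqnSn.
- exact: (sort_sorted geto).
Qed.

End Shift.

Definition beta (R : numFieldType) (n : nat) : R := 1 - (1 - n%:R^-1) ^+ n.

(* {0,1}-matrices are boolean matrices; [mx01] reads them as integer ones. *)
Definition mx01 d n (x : 'M[bool]_(d, n)) : 'M[int]_(d, n) :=
  map_mx (fun b : bool => (b : nat)%:Z) x.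

Section IndependenceSystem.
Variables (d n : nat) (S : {set 'cV[bool]_d}).

Definition independence_system : Prop :=
  const_mx false \in S /\
  forall u v : 'cV[bool]_d,
    (forall i, u i 0 -> v i 0) -> v \in S -> u \in S.

Definition power : {set 'M[bool]_(d, n)} :=
  [set x | [forall j, col j x \in S]].

(* The default value 0 of the iterated maximum is attained (at z = 0) as soon
   as S contains 0, see [optimum_max]. *)
Definition optimum (c : 'M[int]_(d, n)) : int :=
  \big[Order.max/0]_(z in power) pairing c (shift (mx01 z)).

Lemma optimum_max c : const_mx false \in S ->
  (exists2 z, z \in power & pairing c (shift (mx01 z)) = optimum c) /\
  (forall z, z \in power -> pairing c (shift (mx01 z)) <= optimum c).
Proof.
move=> S0; split=> [|z Sz]; last exact: le_bigmax_cond.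
have Sz0 : const_mx false \in power.
  by rewrite inE; apply/forallP=> j; rewrite col_const.
have z0E : pairing c (shift (mx01 (const_mx false))) = 0.
  rewrite /pairing big1 // => i _; rewrite big1 // => j _.
  have <- : mx01 (const_mx false) = shift (mx01 (const_mx false : 'M_(d, n))).
    apply/shiftP; split=> [k | k l m _]; last by rewrite !mxE.
    by exists 1%g => l; rewrite !mxE.
  by rewrite !mxE mulr0.
apply: (big_rec (fun m => exists2 z, z \in power &
          pairing c (shift (mx01 z)) = m)) => [|z' m Sz' [w Sw Ew]].
  by exists (const_mx false).
by rewrite /Order.max; case: ifP => _; [exists w | exists z'].
Qed.

End IndependenceSystem.

Inductive symbol : Type := Blank | Zero | One | Minus | Comma | Semicolon.

Definition is_blank (a : symbol) : bool := if a is Blank then true else false.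

Definition bit (b : bool) : symbol := if b then One else Zero.

(* Binary digits, most significant first. *)
Definition encode_nat (m : nat) : seq symbol :=
  rev [seq bit (odd (m %/ 2 ^ i)) | i <- iota 0 (trunc_log 2 m).+1].

Definition encode_int (z : int) : seq symbol :=
  (if z < 0 then [:: Minus] else [::]) ++ encode_nat `|z|%N.

(* Row by row; each entry ends with [Comma] and each row with [Semicolon]. *)
Definition encode d n (x : 'M[int]_(d, n)) : seq symbol :=
  flatten [seq rcons (flatten [seq rcons (encode_int (x i j)) Comma
                              | j <- enum 'I_n]) Semicolon
          | i <- enum 'I_d].

(* A two-way infinite tape is a pair of sequences: the cells to the left of the
   head, nearest first, and the cells from the head on; the cells that are not
   listed are blank. *)
Definition tape : Type := (seq symbol * seq symbol)%type.

Inductive move : Type := ToLeft | ToRight | Stay.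

Definition read (t : tape) : symbol := head Blank t.2.

Definition act (a : symbol * move) (t : tape) : tape :=
  let r := a.1 :: behead t.2 in
  match a.2 with
  | ToLeft => (behead t.1, head Blank t.1 :: r)
  | ToRight => (a.1 :: t.1, behead r)
  | Stay => (t.1, r)
  end.

(* The longest blank-free word starting at the head. *)
Definition word (t : tape) : seq symbol := take (find is_blank t.2) t.2.

(* Deterministic multitape oracle Turing machines. The first tape is for input
   and output, the last one for oracle queries and answers. A state [q] with
   [ask q = Some q'] is a query state, with successor [q']. *)
Record oracle_machine := OracleMachine {
  work_tapes : nat;
  state : finType;
  init : state;
  final : pred state;
  ask : state -> option state;
  trans : state -> {ffun 'I_work_tapes.+2 -> symbol} ->
          state * {ffun 'I_work_tapes.+2 -> symbol * move}
}.

Section Run.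
Variables (M : oracle_machine) (O : seq symbol -> seq symbol).

Definition config : Type :=
  (state M * {ffun 'I_(work_tapes M).+2 -> tape})%type.

(* A query takes one step: the word on the oracle tape is replaced by the
   oracle's answer. *)
Definition step (s : config) : config :=
  let: (q, T) := s in
  if final q then s else
  if ask q is Some q' then
    (q', [ffun i => if i == ord_max then ([::], O (word (T i))) else T i])
  else
    let: (q', a) := trans q [ffun i => read (T i)] in
    (q', [ffun i => act (a i) (T i)]).

Definition start (x : seq symbol) : config :=
  (init M, [ffun i => if i == ord0 then ([::], x) else ([::], [::])]).

Definition halts_with (x y : seq symbol) (t : nat) : Prop :=
  let: (q, T) := iter t step (start x) in final q /\ word (T ord0) = y.

End Run.

(* Nothing is assumed on the answers to words that do not encode a vector of
   Z^d. *)
Definition linear_optimization_oracle d (S : {set 'cV[bool]_d})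
    (O : seq symbol -> seq symbol) : Prop :=
  forall w : 'cV[int]_d, exists s : 'cV[bool]_d,
    [/\ s \in S,
        forall u, u \in S -> pairing w (mx01 u) <= pairing w (mx01 s)
      & O (encode w) = encode (mx01 s)].

(* Main.v *)
(** The columns of [y] are chosen greedily. If [k i] counts the ones already
    placed in row [i], the next column is an oracle answer to the weights
    [c i (k i)], its marginal gains. Row values are concave in the counts and
    [S] is downward closed, so the gap to the optimum is at most [n] times the
    gain of the column; hence every round shrinks the gap by the factor
    [1 - 1/n], and [n] rounds give [beta].

    The machine keeps [c] on its second tape, where a used entry is overwritten
    by commas. The output tape holds the rows [-,-,...,-,;] whose minus signs
    are replaced from left to right by the oracle's bits; the machine halts
    when a rewind of this tape meets no minus sign. *)

Require Import Defs.
From HB Require Import structures.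
From mathcomp Require Import all_boot all_order all_algebra.
From mathcomp Require Import reals sequences exp.
From mathcomp Require Import zify lra.

Set Implicit Arguments.
Unset Strict Implicit.
Unset Printing Implicit Defensive.

Import Order.TTheory GRing.Theory Num.Theory.

(** The machine does no arithmetic. The weights of a query are entries of [c], so it only copies
    words of its input; [d], [n] and the counts [k i] are never computed, but are held in unary by
    the commas, semicolons and minus signs on the tapes. Entries of [c] may be negative, so the
    objective is not monotone and the classical greedy estimate does not apply directly. Downward
    closure repairs this twice: an optimal answer never picks a row of negative gain, and replacing
    the gains by their positive parts does not raise the maximum over [S]. The guarantee is carried
    through the rounds in integers, with the denominators [n ^ t] cleared. *)

Lemma notin_cons (T : eqType) (a c : T) s :
  (a \notin c :: s) = (c != a) && (a \notin s).
Proof. by rewrite inE negb_or eq_sym. Qed.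

Lemma nseq_cat_cons (T : Type) n (a : T) s :
  nseq n a ++ a :: s = a :: nseq n a ++ s.
Proof. by elim: n => //= n ->. Qed.

(** * Runs of oracle machines *)

(* Two tapes are equal when they carry the same cells: the finite sequences may
   differ by trailing blanks. *)
Definition tape_eq (t t' : tape) : Prop :=
  nth Blank t.1 =1 nth Blank t'.1 /\ nth Blank t.2 =1 nth Blank t'.2.

Lemma tape_eq_trans t1 t2 t3 : tape_eq t1 t2 -> tape_eq t2 t3 -> tape_eq t1 t3.
Proof. by move=> [? ?] [? ?]; split; apply: ftrans; eassumption. Qed.

Lemma tape_eq_sym t1 t2 : tape_eq t1 t2 -> tape_eq t2 t1.
Proof. by move=> [? ?]; split; apply: fsym. Qed.

Lemma eq_read t t' : tape_eq t t' -> read t = read t'.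
Proof. by case=> _ /(_ 0); rewrite !nth0. Qed.

Lemma eq_act a t t' : tape_eq t t' -> tape_eq (act a t) (act a t').
Proof.
case: a t t' => a m [l r] [l' r'] [/= El Er].
have hl := El 0; rewrite !nth0 in hl.
case: m; split=> //= -[|k] //=; rewrite ?nth_behead //; case: k => [|k] //=.
by rewrite !nth_behead.
Qed.

Lemma eq_word t t' : tape_eq t t' -> word t = word t'.
Proof.
case: t t' => l r [l' r'] [/= _]; rewrite /word /= => {l l'}.
elim: r r' => [|a r IHr] [|a' r'] //= E.
- by have /= <- := E 0.
- by have /= -> := E 0.
have /= Ea := E 0; rewrite -Ea; case: ifP => //= _; congr (_ :: _).
by apply: IHr => k; apply: (E k.+1).
Qed.

Lemma tape_eq_nseql l r k : tape_eq (l ++ nseq k Blank, r) (l, r).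
Proof.
split=> //= i; rewrite nth_cat nth_nseq if_same.
by case: ltnP => // /(nth_default Blank).
Qed.

Lemma tape_eq_nseqr l r k : tape_eq (l, r ++ nseq k Blank) (l, r).
Proof.
split=> //= i; rewrite nth_cat nth_nseq if_same.
by case: ltnP => // /(nth_default Blank).
Qed.

Section Runs.
Variables (M : oracle_machine) (O : seq symbol -> seq symbol).
Implicit Types s : config M.

Definition config_eq s s' : Prop :=
  s.1 = s'.1 /\ forall i, tape_eq (s.2 i) (s'.2 i).

Lemma step_trans q (T : {ffun 'I_(work_tapes M).+2 -> tape}) :
  final q = false -> ask q = None ->
  step O (q, T) =
  ((trans q [ffun i => read (T i)]).1,
   [ffun i => act ((trans q [ffun i => read (T i)]).2 i) (T i)]).
Proof. by rewrite /step => -> ->; case: trans. Qed.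

Lemma eq_step s s' : config_eq s s' -> config_eq (step O s) (step O s').
Proof.
case: s s' => q T [q' T'] [/= <- ET]; rewrite /step.
case: ifP => // _; case: (ask q) => [q1|]; split=> //=.
- move=> i; rewrite !ffunE; case: ifP => // _.
  by rewrite (eq_word (ET i)).
- have -> // : [ffun i => read (T i)] = [ffun i => read (T' i)].
    by apply/ffunP=> i; rewrite !ffunE (eq_read (ET i)).
  by case: (trans _ _).
have -> : [ffun i => read (T i)] = [ffun i => read (T' i)].
  by apply/ffunP=> i; rewrite !ffunE (eq_read (ET i)).
by case: (trans _ _) => q2 a i; rewrite !ffunE; apply: eq_act.
Qed.

(** An upper bound on the time, not an exact count: branches of different lengths then fit under one
    bound, by [runs_le]. The target is met only up to trailing blanks, which later steps cannot
    distinguish, by [eq_step]. *)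
Definition runs m s s' : Prop :=
  exists2 k, k <= m & config_eq (iter k (step O) s) s'.

Lemma runs0 m s s' : config_eq s s' -> runs m s s'.
Proof. by exists 0. Qed.

Lemma runsS m s s' : runs m (step O s) s' -> runs m.+1 s s'.
Proof. by case=> k lekm E; exists k.+1; rewrite ?iterSr. Qed.

Lemma runs_le m m' s s' : m <= m' -> runs m s s' -> runs m' s s'.
Proof. by move=> lem [k lekm E]; exists k => //; apply: leq_trans lem. Qed.

Lemma runs_trans m1 m2 s1 s2 s3 :
  runs m1 s1 s2 -> runs m2 s2 s3 -> runs (m1 + m2) s1 s3.
Proof.
case=> k1 le1 [E1 F1] [k2 le2 E2]; exists (k2 + k1); first by lia.
rewrite iterD; move: (iter k1 _ _) E1 F1 => s E1 F1 {s1 le1}.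
have: config_eq (iter k2 (step O) s) (iter k2 (step O) s2).
  by elim: k2 {le2 E2} => [|k IHk] //=; apply: eq_step.
case: E2 => E F [E' F']; split; first by rewrite E' E.
by move=> i; apply: tape_eq_trans (F i).
Qed.

Lemma runs_eql m s1 s2 s3 :
  config_eq s1 s2 -> runs m s2 s3 -> runs m s1 s3.
Proof. by move=> E; apply: (@runs_trans 0); apply: runs0. Qed.

Lemma runs_eqr m s1 s2 s3 :
  config_eq s2 s3 -> runs m s1 s2 -> runs m s1 s3.
Proof.
by move=> E r; rewrite -[m]addn0; apply: runs_trans r _; apply: runs0.
Qed.

End Runs.

(** * The greedy machine *)

Inductive phase : Type :=
  Copy | Template | TemplateSlot | Build | BuildEntry | BuildSkip
| RewindQuery | Ask | Fill | DropSkip | Drop | NextRow | Rewind | Halt.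

Definition phases : seq phase :=
  [:: Copy; Template; TemplateSlot; Build; BuildEntry; BuildSkip;
      RewindQuery; Ask; Fill; DropSkip; Drop; NextRow; Rewind; Halt].

Definition phase_code (q : phase) : nat :=
  match q with
  | Copy => 0 | Template => 1 | TemplateSlot => 2 | Build => 3
  | BuildEntry => 4 | BuildSkip => 5 | RewindQuery => 6 | Ask => 7
  | Fill => 8 | DropSkip => 9 | Drop => 10 | NextRow => 11
  | Rewind => 12 | Halt => 13
  end.

Lemma phase_codeK : cancel phase_code (nth Copy phases).
Proof. by case. Qed.

HB.instance Definition _ := Countable.copy phase (can_type phase_codeK).

Lemma phases_enum : Finite.axiom phases. Proof. by case. Qed.

HB.instance Definition _ := isFinite.Build phase phases_enum.

Definition symbol_code (a : symbol) : nat :=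
  match a with
  | Blank => 0 | Zero => 1 | One => 2 | Minus => 3 | Comma => 4 | Semicolon => 5
  end.

Lemma symbol_codeK :
  cancel symbol_code (nth Blank [:: Blank; Zero; One; Minus; Comma; Semicolon]).
Proof. by case. Qed.

HB.instance Definition _ := Equality.copy symbol (can_type symbol_codeK).

Definition action : Type := option (symbol * move).

Definition left_unless (stop a : symbol) : action :=
  if a == stop then None else Some (a, ToLeft).

Definition right_unless (stop a : symbol) : action :=
  if a == stop then None else Some (a, ToRight).

Definition erase_unless (stop a : symbol) : action :=
  if a == stop then None else Some (Blank, ToRight).

Notation write_left a := (Some (a, ToLeft)).
Notation write_right a := (Some (a, ToRight)).

(** The three words differ in length: a head that has met its blank waits there, and once all wait
    they step right together. *)
Definition rewind (q next : phase) (f : bool) (x a w : symbol) :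
    (phase * bool) * action * action * action :=
  if [&& x == Blank, a == Blank & w == Blank] then
    ((next, f), write_right Blank, write_right Blank, write_right Blank)
  else
    ((q, f || (x == Minus)), left_unless Blank x, left_unless Blank a,
     left_unless Blank w).

(* [x], [a] and [w] are read on the output tape, the tape of remaining entries
   and the oracle tape; the action [None] leaves a tape untouched.
   [Copy] copies the input; [Template] reads the copy backwards and writes the
   rows of empty slots over the input, with a separating blank on their left.
   A round writes the first remaining entry of each row on the oracle tape
   ([Build] to [BuildSkip]), asks, and then for each row moves the answered bit
   to the first empty slot ([Fill]) and, if it is 1, drops the entry
   ([DropSkip], [Drop]). The flag records whether an empty slot has been written
   ([Template]) or met ([Rewind]). *)
Definition delta (q : phase * bool) (x a w : symbol) :
    (phase * bool) * action * action * action :=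
  let: (q, f) := q in
  match q with
  | Copy =>
    if x is Blank then ((Template, false), None, write_left a, None)
    else ((Copy, f), write_right x, write_right x, None)
  | Template =>
    match a with
    | Blank =>
      ((if f then Build else Halt, false),
       write_right Blank, write_right Blank, None)
    | Semicolon => ((Template, f), write_left Semicolon, write_left a, None)
    | Comma => ((TemplateSlot, true), write_left Comma, None, None)
    | _ => ((Template, f), None, write_left a, None)
    end
  | TemplateSlot => ((Template, true), write_left Minus, write_left a, None)
  | Build =>
    match a with
    | Comma => ((Build, f), None, write_right a, None)
    | Blank => ((RewindQuery, f), write_left x, write_left a, write_left w)
    | _ => ((BuildEntry, f), None, None, None)
    end
  | BuildEntry =>
    if a is Comma then ((BuildSkip, f), None, None, write_right Comma)
    else ((BuildEntry, f), None, write_right a, write_right a)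
  | BuildSkip =>
    if a is Semicolon then
      ((Build, f), None, write_right a, write_right Semicolon)
    else ((BuildSkip, f), None, write_right a, None)
  | RewindQuery => rewind RewindQuery Ask f x a w
  | Fill =>
    if w is Blank then
      ((Rewind, false), write_left x, write_left a, write_left w)
    else if x is Minus then
      ((if w is One then DropSkip else NextRow, f),
       Some (w, Stay), None, write_right Blank)
    else ((Fill, f), write_right x, None, None)
  | DropSkip =>
    if a is Comma then ((DropSkip, f), None, write_right a, None)
    else ((Drop, f), None, None, None)
  | Drop =>
    if a is Comma then ((NextRow, f), None, None, None)
    else ((Drop, f), None, write_right Comma, None)
  | NextRow =>
    if [&& x == Semicolon, a == Semicolon & w == Semicolon] then
      ((Fill, f), write_right x, write_right a, write_right Blank)
    else
      ((NextRow, f), right_unless Semicolon x, right_unless Semicolon a,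
       erase_unless Semicolon w)
  | Rewind => rewind Rewind (if f then Build else Halt) f x a w
  | Ask | Halt => ((Halt, f), None, None, None)
  end.

Definition tape_tuple (T : Type) (x a w : T) (i : 'I_3) : T :=
  match nat_of_ord i with 0 => x | 1 => a | _ => w end.

Definition greedy_trans (q : phase * bool) (r : {ffun 'I_3 -> symbol}) :
    (phase * bool) * {ffun 'I_3 -> symbol * move} :=
  let: (q', x, a, w) := delta q (r ord0) (r (inord 1)) (r ord_max) in
  (q', [ffun i => odflt (r i, Stay) (tape_tuple x a w i)]).

Definition greedy_machine : oracle_machine := {|
  work_tapes := 1;
  state := (phase * bool)%type;
  init := (Copy, false);
  final := [pred q | q.1 == Halt];
  ask := fun q => if q.1 is Ask then Some (Fill, false) else None;
  trans := greedy_trans |}.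

Definition upd (a : action) (t : tape) : tape :=
  if a is Some a' then act a' t else t.

(** * Runs of the single phases *)

Section Greedy.
Variable O : seq symbol -> seq symbol.
Local Notation M := greedy_machine.

Definition conf (q : phase) (f : bool) (x a w : tape) : config M :=
  ((q, f), [ffun i => tape_tuple x a w i]).

Local Notation steps := (runs O).

Lemma step_ask f x a w :
  step O (conf Ask f x a w) = conf Fill false x a ([::], O (word w)).
Proof.
rewrite /step /=; congr (_, _); apply/ffunP=> i; rewrite !ffunE.
by case: i => [[|[|[|]]] ?].
Qed.

Lemma conf_eq q f x a w x' a' w' :
  tape_eq x x' -> tape_eq a a' -> tape_eq w w' ->
  config_eq (conf q f x a w) (conf q f x' a' w').
Proof.
by move=> ? ? ?; split=> // i; rewrite !ffunE; case: i => [[|[|[|]]] ?].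
Qed.

(** Only up to trailing blanks: [greedy_trans] realizes the action [None] by rewriting the symbol
    read, which turns an empty right half into a listed blank. *)
Lemma step_conf q f x a w : q != Halt -> q != Ask ->
  config_eq (step O (conf q f x a w))
  (let: ((q', f'), x', a', w') := delta (q, f) (read x) (read a) (read w) in
   conf q' f' (upd x' x) (upd a' a) (upd w' w)).
Proof.
move=> /negPf nH nA; rewrite /conf step_trans //; last by case: q nA {nH}.
rewrite -[trans _ _]/(greedy_trans _ _) /greedy_trans.
rewrite !ffunE /tape_tuple inordK //.
rewrite -[nat_of_ord ord0]/0 -[nat_of_ord ord_max]/2.
case: (delta _ _ _ _) => [[[[q' f'] x'] a'] w']; split=> // i.
have stay t b : tape_eq (act (odflt (read t, Stay) b) t) (upd b t).
  case: b => [b|] //=; case: t => l [|c r]; split=> //= -[|k] //.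
  by rewrite /= !nth_nil; case: k.
by rewrite !ffunE; case: i => [[|[|[|]]] ?] //=; apply: stay.
Qed.

Lemma runs_step m q f x a w s : q != Halt -> q != Ask ->
  (let: ((q', f'), x', a', w') := delta (q, f) (read x) (read a) (read w) in
   steps m (conf q' f' (upd x' x) (upd a' a) (upd w' w)) s) ->
  steps m.+1 (conf q f x a w) s.
Proof.
move=> nH nA; have := step_conf f x a w nH nA.
case: (delta _ _ _ _) => [[[[? ?] ?] ?] ?] E H.
by apply: runsS; apply: runs_eql H.
Qed.

Lemma copy_runs f u v r b : all (predC is_blank) r ->
  steps (size r + 1) (conf Copy f (u, r) (v, [::]) b)
    (conf Template false (rev r ++ u, [::])
       (act (Blank, ToLeft) (rev r ++ v, [::])) b).
Proof.
elim: r u v => [|x r IHr] u v /=.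
  by move=> _; apply: runs_step => //=; apply: runs0.
case/andP=> nx nr; rewrite addSn; apply: runs_step => //=.
rewrite !rev_cons !cat_rcons.
by case: x nx => //= _; apply: IHr.
Qed.

Definition slot (a : symbol) : seq symbol :=
  match a with
  | Comma => [:: Minus; Comma] | Semicolon => [:: Semicolon] | _ => [::]
  end.

(** The copy is read from its right end, hence the induction on the last symbol; a comma takes two
    steps, whence the factor 2. Whatever lies to the left of the template is [g]; the written blank
    keeps later rewinds out of it. *)
Lemma template_runs f x r w v : Blank \notin r ->
  exists g, steps (2 * size r + 1)
    (conf Template f x (behead (rev r), head Blank (rev r) :: v) w)
    (conf (if f || (Comma \in r) then Build else Halt) false
       (Blank :: g, flatten (map slot r) ++ behead x.2) ([:: Blank], r ++ v) w).
Proof.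
elim/last_ind: r f x v => [|r c IHr] f x v.
  by move=> _; exists x.1; apply: runs_step => //=; rewrite orbF; apply: runs0.
rewrite mem_rcons inE negb_or eq_sym => /andP[nc nr].
rewrite size_rcons rev_rcons /= map_rcons flatten_rcons cat_rcons mem_rcons inE.
rewrite orbCA mulnS -addnA -catA.
have H := IHr f x (c :: v) nr.
case: c nc H => //= _; try
  by case=> g Hg; exists g; apply: runs_step => //=; apply: runs_le Hg; lia.
- move=> _; pose x' := act (Minus, ToLeft) (act (Comma, ToLeft) x).
  case: (IHr true x' (Comma :: v) nr) => g Hg; exists g.
  by apply: runs_step => //=; apply: runs_step.
- move=> _; pose x' := act (Semicolon, ToLeft) x.
  case: (IHr f x' (Semicolon :: v) nr) => g Hg; exists g.
  by apply: runs_step => //=; apply: runs_le Hg.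
Qed.

Definition digit (a : symbol) : bool := a \in [:: Zero; One; Minus].

Lemma build_pad_runs f x u p r w m s :
  steps m (conf Build f x (nseq p Comma ++ u, r) w) s ->
  steps (p + m) (conf Build f x (u, nseq p Comma ++ r) w) s.
Proof.
elim: p u => [|p IHp] u H //=; apply: runs_step => //=; apply: IHp.
by rewrite nseq_cat_cons.
Qed.

Lemma build_entry_runs f x u e r q m s : all digit e ->
  steps m (conf BuildEntry f x (rev e ++ u, r) (rev e ++ q, [::])) s ->
  steps (size e + m) (conf BuildEntry f x (u, e ++ r) (q, [::])) s.
Proof.
elim: e u q => [|c e IHe] u q //= /andP[dc de].
rewrite !rev_cons !cat_rcons => H.
by apply: runs_step => //=; case: c dc H => //= _ H; apply: IHe.
Qed.

Lemma build_skip_runs f x u e r q m s : Semicolon \notin e ->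
  steps m
    (conf Build f x (Semicolon :: rev e ++ u, r) (Semicolon :: q, [::])) s ->
  steps (size e + 1 + m)
    (conf BuildSkip f x (u, e ++ Semicolon :: r) (q, [::])) s.
Proof.
elim: e u => [|c e IHe] u /=; first by move=> _ H; apply: runs_step.
rewrite inE negb_or => /andP[nc ne]; rewrite rev_cons cat_rcons => H.
by apply: runs_step => //=; case: c nc H => //= _ H; apply: IHe.
Qed.

Lemma build_row_runs f x u p e rs r q m s :
  e != [::] -> all digit e -> Semicolon \notin rs ->
  steps m (conf Build f x
    (rev (nseq p Comma ++ e ++ Comma :: rs ++ [:: Semicolon]) ++ u, r)
    (rev (e ++ [:: Comma; Semicolon]) ++ q, [::])) s ->
  steps (p + size e + size rs + 4 + m)
   (conf Build f x (u, nseq p Comma ++ e ++ Comma :: rs ++ Semicolon :: r)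
      (q, [::])) s.
Proof.
move=> e0 de ns H; rewrite -!addnA; apply: build_pad_runs.
rewrite (_ : _ + _ = (size e + (size (Comma :: rs) + 1 + m).+1).+1);
  last by rewrite /=; lia.
case: e e0 de H => // c e _ de H; apply: runs_step => //.
rewrite (_ : delta _ _ _ _ = ((BuildEntry, f), None, None, None)); last first.
  by case: c de {H}.
rewrite /= -cat_cons -[(size e).+1]/(size (c :: e)).
apply: build_entry_runs => //.
apply: runs_step => //=; rewrite -[in X in runs _ _ X _]cat_cons.
apply: (@build_skip_runs f x _ (Comma :: rs)) => //.
move: H; rewrite !(rev_cat, rev_cons) /= -!cats1 !catA /=.
by rewrite !rev_nseq -!catA.
Qed.

(* The head stands on the last cell of the word [rev r], which is followed by
   [v]; [l] lies beyond the blank at which the rewind stops. *)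
Definition rewinding (r l v : seq symbol) : tape :=
  (behead (r ++ Blank :: l), head Blank (r ++ Blank :: l) :: v).

Lemma upd_left_unless r l v : Blank \notin r ->
  upd (left_unless Blank (head Blank (r ++ Blank :: l))) (rewinding r l v) =
  rewinding (behead r) l (if r is c :: _ then c :: v else v).
Proof.
by case: r => //= c r; rewrite notin_cons /left_unless => /andP[/negPf->].
Qed.

(** The successor [next] is a function of the flag, so that one statement serves both the rewind
    before a query and the one that chooses between another round and halting. Since heads wait for
    each other, the longest word sets the time. *)
Lemma rewind_runs q next f m r0 r1 r2 l0 l1 l2 v0 v1 v2 :
  q != Halt -> q != Ask ->
  (forall g, delta (q, g) = rewind q (next g) g) ->
  Blank \notin r0 -> Blank \notin r1 -> Blank \notin r2 ->
  size r0 <= m -> size r1 <= m -> size r2 <= m ->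
  steps m.+1
    (conf q f (rewinding r0 l0 v0) (rewinding r1 l1 v1) (rewinding r2 l2 v2))
    (conf (next (f || (Minus \in r0))) (f || (Minus \in r0))
       (Blank :: l0, rev r0 ++ v0)
       (Blank :: l1, rev r1 ++ v1) (Blank :: l2, rev r2 ++ v2)).
Proof.
move=> qH qA dq.
elim: m f r0 r1 r2 v0 v1 v2 => [|m IHm] f r0 r1 r2 v0 v1 v2 b0 b1 b2.
  rewrite !leqn0 !size_eq0 => /eqP-> /eqP-> /eqP->; rewrite orbF.
  by apply: runs_step; rewrite ?dq //= /rewind /=; apply: runs0.
have behead_size (r : seq symbol) : size r <= m.+1 -> size (behead r) <= m.
  by rewrite size_behead; lia.
have behead_blank (r : seq symbol) : Blank \notin r -> Blank \notin behead r.
  by apply: contra; apply: mem_behead.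
move=> s0 s1 s2; apply: runs_step => //; rewrite dq /rewind.
case: ifP.
  case: r0 r1 r2 b0 b1 b2 {s0 s1 s2} => [|c0 r0] [|c1 r1] [|c2 r2];
    rewrite ?notin_cons //= => b0 b1 b2.
  - by move=> _; rewrite orbF; apply: runs0.
  - by case: eqP b2.
  - by case: eqP b1.
  - by case: eqP b1.
  - by case: eqP b0.
  - by case: eqP b0.
  - by case: eqP b0.
  - by case: eqP b0.
move=> _; rewrite ![read (rewinding _ _ _)]/(head _ _) !upd_left_unless //.
have revE (r v : seq symbol) :
    rev r ++ v = rev (behead r) ++ (if r is c :: _ then c :: v else v).
  by case: r => //= c r; rewrite rev_cons cat_rcons.
have minusE : (f || (Minus \in r0)) =
    (f || (head Blank (r0 ++ Blank :: l0) == Minus)) || (Minus \in behead r0).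
  case: r0 {b0 s0} => [|c r0]; first by rewrite in_nil !orbF.
  by rewrite inE orbA [Minus == _]eq_sym.
by rewrite (revE r0) (revE r1) (revE r2) minusE; apply: IHm; auto.
Qed.

(** Each head waits at its own semicolon, so again the longest word sets the time. The oracle tape
    is blanked on the way, so that the next query is written on an empty tape. *)
Lemma next_row_runs f m u0 u1 u2 r0 r1 r2 v0 v1 v2 k s :
  Semicolon \notin r0 -> Semicolon \notin r1 -> Semicolon \notin r2 ->
  size r0 <= m -> size r1 <= m -> size r2 <= m ->
  steps k
    (conf Fill f (Semicolon :: rev r0 ++ u0, v0) (Semicolon :: rev r1 ++ u1, v1)
       (nseq (size r2).+1 Blank ++ u2, v2)) s ->
  steps (m.+1 + k)
    (conf NextRow f (u0, r0 ++ Semicolon :: v0) (u1, r1 ++ Semicolon :: v1)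
       (u2, r2 ++ Semicolon :: v2)) s.
Proof.
elim: m u0 u1 u2 r0 r1 r2 => [|m IHm] u0 u1 u2 r0 r1 r2 b0 b1 b2.
  rewrite !leqn0 !size_eq0 => /eqP-> /eqP-> /eqP-> H.
  by apply: runs_step.
move=> s0 s1 s2 H; rewrite addSn; apply: runs_step => //=.
have {IHm} := IHm (if r0 is c :: _ then c :: u0 else u0)
  (if r1 is c :: _ then c :: u1 else u1)
  (if r2 is _ :: _ then Blank :: u2 else u2)
  (behead r0) (behead r1) (behead r2).
case: r0 r1 r2 b0 b1 b2 s0 s1 s2 H => [|c0 r0] [|c1 r1] [|c2 r2];
  rewrite ?notin_cons /right_unless /erase_unless /= => b0 b1 b2 s0 s1 s2 H.
  by move=> _; apply: runs_le H; lia.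
all: repeat match goal with b : is_true (_ && _) |- _ =>
       case/andP: b => [/negPf ? ?] end.
all: repeat match goal with b : (_ == _) = false |- _ => rewrite b {b} end.
all: rewrite ?andbF /=; apply => //; move: H;
     rewrite ?rev_cons ?cat_rcons ?nseq_cat_cons //.
Qed.

Lemma fill_scan_runs f g r a w bs m s :
  read w != Blank -> Minus \notin bs ->
  steps m (conf Fill f (rev bs ++ g, r) a w) s ->
  steps (size bs + m) (conf Fill f (g, bs ++ r) a w) s.
Proof.
move=> nw; elim: bs g => [|c bs IHb] g //=; rewrite notin_cons => /andP[nc nb].
rewrite rev_cons cat_rcons addSn => H; apply: runs_step => //=.
have {}IHb := IHb (c :: g) nb H.
by case: (read w) nw => // _; case: c nc {H} IHb.
Qed.

Lemma drop_skip_runs f x u p r w m s :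
  steps m (conf DropSkip f x (nseq p Comma ++ u, r) w) s ->
  steps (p + m) (conf DropSkip f x (u, nseq p Comma ++ r) w) s.
Proof.
elim: p u => [|p IHp] u H //=; rewrite addSn; apply: runs_step => //=.
by apply: IHp; rewrite nseq_cat_cons.
Qed.

Lemma drop_entry_runs f x u e r w m s : all digit e ->
  steps m (conf Drop f x (nseq (size e) Comma ++ u, r) w) s ->
  steps (size e + m) (conf Drop f x (u, e ++ r) w) s.
Proof.
elim: e u => [|c e IHe] u //= /andP[dc de] H; rewrite addSn.
apply: runs_step => //=; have := IHe (Comma :: u) de.
by rewrite nseq_cat_cons => /(_ H); case: c dc.
Qed.

(** The part [p + size e] is charged twice: once for skipping and dropping when the bit is 1, once
    in a bound on the walk to the semicolons that is uniform in [b]. The hypothesis on [bt] lets the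
    row of entries bound that walk on the output tape too. *)
Lemma fill_row_runs f g u q p (e rs : seq symbol) r b (bs bt : seq symbol)
    xv wv m s :
  all digit e -> e != [::] -> Semicolon \notin rs ->
  Minus \notin bs -> Semicolon \notin bt ->
  size bt <= p + size e + size rs ->
  steps m (conf Fill f (rev (bs ++ bit b :: bt ++ [:: Semicolon]) ++ g, xv)
    (rev (nseq p Comma ++ (if b then nseq (size e) Comma else e) ++
       Comma :: rs ++ [:: Semicolon]) ++ u, r)
    (nseq 3 Blank ++ q, wv)) s ->
  steps (size bs + 2 * (p + size e) + size rs + 5 + m)
    (conf Fill f (g, bs ++ Minus :: bt ++ Semicolon :: xv)
      (u, nseq p Comma ++ e ++ Comma :: rs ++ Semicolon :: r)
      (q, [:: bit b, Comma, Semicolon & wv])) s.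
Proof.
move=> de e0 nrs nbs nbt lebt H; rewrite -!addnA.
apply: fill_scan_runs => //; first by case: b {H}.
apply: (@runs_le _ _
  (p + (size e + (p + size e + size rs + 1).+1 + m)).+3); first by lia.
apply: runs_step => //.
have -> : delta (Fill, f) (read (rev bs ++ g, Minus :: bt ++ Semicolon :: xv))
    (read (u, nseq p Comma ++ e ++ Comma :: rs ++ Semicolon :: r))
    (read (q, [:: bit b, Comma, Semicolon & wv])) =
  ((if b then DropSkip else NextRow, f), Some (bit b, Stay), None,
    write_right Blank) by case: (b).
rewrite /=; case: b H => H.
  rewrite -addnS -addnS; apply: drop_skip_runs.
  apply: runs_step => //.
  rewrite (_ : delta _ _ _ _ = ((Drop, f), None, None, None)); last first.
    by case: e e0 de {H lebt} => // c e _; case: c.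
  rewrite /= -addnA -addnS; apply: drop_entry_runs => //.
  apply: runs_step => //=.
  apply: (@next_row_runs f _ _ _ _ (One :: bt) (Comma :: rs) [:: Comma]);
    rewrite //=; try lia.
  move: H; rewrite ?(rev_cons, rev_cat, rev_nseq, cat_rcons) /=.
  by rewrite -?cats1 -?catA.
apply: (@runs_le _ _ ((p + size e + size rs + 1).+1 + m)); first by lia.
have -> : nseq p Comma ++ e ++ Comma :: rs ++ Semicolon :: r =
    (nseq p Comma ++ e ++ Comma :: rs) ++ Semicolon :: r by rewrite -!catA.
apply: (@next_row_runs f _ _ _ _ (Zero :: bt) _ [:: Comma]) => //=.
- rewrite !mem_cat inE (negPf nrs) mem_nseq andbF /= orbF.
  by apply/negP => /(allP de).
- by rewrite addn1 ltnS.
- by rewrite !size_cat size_nseq /=; lia.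
- by lia.
by move: H; rewrite ?(rev_cons, rev_cat, rev_nseq, cat_rcons) /= -?cats1 -?catA.
Qed.

End Greedy.

(** * Rounds *)

Definition word_ok (e : seq symbol) : bool := (e != [::]) && all digit e.

Definition entries (ws : seq (seq symbol)) : seq symbol :=
  flatten [seq rcons e Comma | e <- ws].

(* [ws] are the entries of the row and [s] the bits answered so far: the first
   [count id s] entries have been overwritten. *)
Definition remaining_row (ws : seq (seq symbol)) (s : seq bool) : seq symbol :=
  nseq (size (entries (take (count id s) ws))) Comma ++
  entries (drop (count id s) ws) ++ [:: Semicolon].

Definition query_row (ws : seq (seq symbol)) (s : seq bool) : seq symbol :=
  nth [::] ws (count id s) ++ [:: Comma; Semicolon].

Definition slots (n : nat) : seq symbol := flatten (nseq n [:: Minus; Comma]).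

Definition bits (s : seq bool) : seq symbol :=
  flatten [seq [:: bit b; Comma] | b <- s].

Definition output_row (n : nat) (s : seq bool) : seq symbol :=
  bits s ++ slots (n - size s) ++ [:: Semicolon].

Lemma entries_rcons ws e : entries (rcons ws e) = entries ws ++ rcons e Comma.
Proof. by rewrite /entries map_rcons flatten_rcons. Qed.

Lemma bits_rcons s b : bits (rcons s b) = bits s ++ [:: bit b; Comma].
Proof. by rewrite /bits map_rcons flatten_rcons. Qed.

Lemma size_bits s : size (bits s) = 2 * size s.
Proof. by elim: s => //= b s; rewrite /bits /= => ->; lia. Qed.

Lemma size_slots n : size (slots n) = 2 * n.
Proof. by elim: n => //= n; rewrite /slots /= => ->; lia. Qed.

Lemma mem_slots a n : (a \in slots n) = (0 < n) && (a \in [:: Minus; Comma]).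
Proof.
elim: n => //= n; rewrite /slots /= !inE => ->.
by case: (a == Minus); case: (a == Comma); rewrite ?andbF.
Qed.

Lemma minus_bits s : Minus \notin bits s.
Proof. by elim: s => //= -[] s. Qed.

Lemma blank_bits s : Blank \notin bits s.
Proof. by elim: s => //= -[] s. Qed.

Lemma minus_output_row n s :
  (Minus \in output_row n s) = (size s < n).
Proof.
rewrite /output_row !mem_cat mem_slots (negPf (minus_bits s)) /=.
by rewrite subn_gt0 andbT orbF.
Qed.

Lemma blank_output_row n s : Blank \notin output_row n s.
Proof.
by rewrite /output_row !mem_cat mem_slots (negPf (blank_bits s)) andbF.
Qed.

Lemma notin_entries a ws :
  ~~ digit a -> a != Comma -> all word_ok ws -> a \notin entries ws.
Proof.
move=> da /negPf ca; elim: ws => //= e ws IHws /andP[/andP[_ /allP de] /IHws].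
rewrite /entries /= mem_cat mem_rcons inE ca negb_or /= => ->; rewrite andbT.
by apply: contra da => /de.
Qed.

(** A nonempty word and its comma take at least two cells, the size of an output slot. Hence output
    rows are no longer than input rows, and [n] is bounded by the input length. *)
Lemma size_entries ws : all word_ok ws -> 2 * size ws <= size (entries ws).
Proof.
elim: ws => //= e ws IHws /andP[/andP[e0 _] /IHws].
rewrite /entries /= size_cat size_rcons; case: e e0 => //= c e _; lia.
Qed.

Section Row.
Variables (ws : seq (seq symbol)) (s : seq bool).
Let k := count id s.
Let p := size (entries (take k ws)).
Let e := nth [::] ws k.
Let rs := entries (drop k.+1 ws).

Lemma remaining_rowE : k < size ws ->
  remaining_row ws s = nseq p Comma ++ e ++ Comma :: rs ++ [:: Semicolon].
Proof.
move=> ltk; rewrite /remaining_row -/k -/p (drop_nth [::] ltk).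
by rewrite /entries /= cat_rcons -catA.
Qed.

Lemma remaining_row_rcons b : k < size ws ->
  remaining_row ws (rcons s b) =
  nseq p Comma ++ (if b then nseq (size e) Comma else e) ++
    Comma :: rs ++ [:: Semicolon].
Proof.
case: b => ltk; last first.
  by rewrite -remaining_rowE // /remaining_row -cats1 count_cat /= !addn0.
rewrite /remaining_row -cats1 count_cat /= addn0 addn1 (take_nth [::] ltk).
by rewrite entries_rcons size_cat size_rcons addnS -addn1 !nseqD -!catA.
Qed.

Lemma size_remaining_row :
  size (remaining_row ws s) = (size (entries ws)).+1.
Proof.
rewrite /remaining_row !size_cat size_nseq addnA addn1 -size_cat.
rewrite -[in RHS](cat_take_drop k ws).
by rewrite /entries map_cat flatten_cat.
Qed.

(** The same [p], [e] and [rs] describe the row before and after the answer, in the form that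
    [build_row_runs] and [fill_row_runs] expect. *)
Lemma row_split : all word_ok ws -> count id s < size ws ->
  exists (p : nat) (e rs : seq symbol),
  [/\ e != [::] /\ all digit e, Semicolon \notin rs,
      query_row ws s = e ++ [:: Comma; Semicolon],
      remaining_row ws s = nseq p Comma ++ e ++ Comma :: rs ++ [:: Semicolon]
    & (forall b, remaining_row ws (rcons s b) =
        nseq p Comma ++ (if b then nseq (size e) Comma else e) ++
          Comma :: rs ++ [:: Semicolon]) /\
      size (entries ws) = p + size e + size rs + 1].
Proof.
move=> wok ltk; exists p, e, rs; split.
- by apply/andP; apply: (allP wok); apply: mem_nth.
- by apply: notin_entries => //; apply/allP => w /mem_drop; apply: (allP wok).
- by [].
- exact: remaining_rowE.
split=> [b|]; first exact: remaining_row_rcons.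
have := size_remaining_row; rewrite remaining_rowE // !size_cat size_nseq /=.
by rewrite size_cat /= -/p -/e -/rs; lia.
Qed.

Lemma remaining_row_blank : all word_ok ws -> Blank \notin remaining_row ws s.
Proof.
move=> wok; rewrite /remaining_row !mem_cat mem_nseq andbF /= negb_or andbT.
by apply: notin_entries => //; apply/allP => w /mem_drop; apply: (allP wok).
Qed.

Lemma query_row_blank : all word_ok ws -> Blank \notin query_row ws s.
Proof.
move=> wok; rewrite /query_row mem_cat negb_or andbT.
have [ltk|lek] := ltnP k (size ws); last by rewrite nth_default.
have /andP[_ /allP de] := allP wok _ (mem_nth [::] ltk).
by apply/negP => /de.
Qed.

End Row.

Section Round.
Variable O : seq symbol -> seq symbol.
Local Notation steps := (runs (M := greedy_machine) O).

Variables (I : Type) (n : nat) (ws : I -> seq (seq symbol)).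
Hypothesis ws_ok : forall i, all word_ok (ws i).
Hypothesis size_ws : forall i, size (ws i) = n.

Definition remaining (l : seq I) (s : I -> seq bool) : seq symbol :=
  flatten [seq remaining_row (ws i) (s i) | i <- l].

Definition query (l : seq I) (s : I -> seq bool) : seq symbol :=
  flatten [seq query_row (ws i) (s i) | i <- l].

Definition output (l : seq I) (s : I -> seq bool) : seq symbol :=
  flatten [seq output_row n (s i) | i <- l].

Definition answer (l : seq I) (b : I -> bool) : seq symbol :=
  flatten [seq [:: bit (b i); Comma; Semicolon] | i <- l].

Definition text_size (l : seq I) : nat :=
  \sum_(i <- l) (size (entries (ws i))).+1.

Lemma size_remaining l s : size (remaining l s) = text_size l.
Proof.
elim: l => [|i l IHl]; rewrite /text_size ?big_nil // big_cons /remaining /=.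
by rewrite size_cat IHl size_remaining_row.
Qed.

Variable s : I -> seq bool.
Hypothesis count_s : forall i, count id (s i) < n.

Lemma build_runs f x u q l :
  steps (3 * text_size l + 1)
    (conf Build f x (u, remaining l s) (q, [::]))
    (conf RewindQuery f (act (read x, ToLeft) x)
      (act (Blank, ToLeft) (rev (remaining l s) ++ u, [::]))
      (act (Blank, ToLeft) (rev (query l s) ++ q, [::]))).
Proof.
elim: l u q => [|i l IHl] u q.
  by rewrite addn1; apply: runs_step => //=; apply: runs0.
rewrite /remaining /query /= -/(remaining l s) -/(query l s).
have lt_s : count id (s i) < size (ws i) by rewrite size_ws.
have [p [e [rs [[e0 de] nrs -> -> [_ szE]]]]] := row_split (ws_ok i) lt_s.
apply: (@runs_le _ _ (p + size e + size rs + 4 + (3 * text_size l + 1))).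
  by rewrite /text_size big_cons szE; lia.
rewrite !(rev_cat _ (remaining _ _)) !(rev_cat _ (query _ _)) -!catA /= -catA.
by apply: build_row_runs.
Qed.

Lemma fill_runs b f g u q l :
  (forall i, size (s i) < n) ->
  steps (5 * text_size l + 1)
    (conf Fill f (g, output l s) (u, remaining l s) (q, answer l b))
    (conf Rewind false
      (act (Blank, ToLeft)
         (rev (output l (fun i => rcons (s i) (b i))) ++ g, [::]))
      (act (Blank, ToLeft)
         (rev (remaining l (fun i => rcons (s i) (b i))) ++ u, [::]))
      (act (Blank, ToLeft) (nseq (3 * size l) Blank ++ q, [::]))).
Proof.
move=> size_s; set s' := fun i => rcons (s i) (b i).
elim: l g u q => [|i l IHl] g u q.
  by rewrite addn1; apply: runs_step => //=; apply: runs0.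
have -> : nseq (3 * size (i :: l)) Blank ++ q =
    nseq (3 * size l) Blank ++ nseq 3 Blank ++ q.
  by rewrite catA -nseqD; congr (nseq _ _ ++ _); rewrite /=; lia.
rewrite /remaining /output /answer /=.
rewrite -/(remaining l s) -/(remaining l s') -/(output l s) -/(output l s')
  -/(answer l b).
have lt_s : count id (s i) < size (ws i) by rewrite size_ws.
have [p [e [rs [[e0 de] nrs _ -> [rowE' szE]]]]] := row_split (ws_ok i) lt_s.
have outE : output_row n (s i) =
    bits (s i) ++ Minus ::
    (Comma :: slots (n - size (s i)).-1) ++ [:: Semicolon].
  rewrite /output_row; congr (_ ++ _).
  by case: (n - size (s i)) (subn_gt0 (size (s i)) n) => //; rewrite size_s.
have outE' : output_row n (s' i) = bits (s i) ++ bit (b i) ::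
    (Comma :: slots (n - size (s i)).-1) ++ [:: Semicolon].
  by rewrite /output_row /s' bits_rcons size_rcons subnS -catA.
have le2n := size_entries (ws_ok i); rewrite szE size_ws in le2n.
have lt_n := size_s i.
rewrite rowE' outE outE'.
apply: (@runs_le _ _
  (size (bits (s i)) + 2 * (p + size e) + size rs + 5 + (5 * text_size l + 1))).
  by rewrite size_bits /text_size big_cons szE; lia.
rewrite !(rev_cat _ (remaining _ _)) !(rev_cat _ (output _ _)).
rewrite -!catA /= -!catA /=.
apply: (@fill_row_runs O f g u q p e rs _ (b i) _ (Comma :: slots _)) => //=.
- exact: minus_bits.
- by rewrite notin_cons mem_slots andbF.
- by rewrite size_slots; lia.
Qed.

End Round.

Lemma word_blank_free l r : Blank \notin r -> word (l, r) = r.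
Proof.
rewrite /word /= => nr; suff -> : find is_blank r = size r by rewrite take_size.
by apply: hasNfind; apply: contra nr => /hasP[[]].
Qed.

Lemma left_rewinding r l :
  tape_eq (act (Blank, ToLeft) (r ++ Blank :: l, [::])) (rewinding r l [::]).
Proof. exact: (tape_eq_nseqr _ [:: _] 1). Qed.

(** The output head rests while a query is built, so its step left lands on the separating blank:
    nothing is left to rewind. *)
Lemma left_rewinding0 l r :
  tape_eq (act (head Blank r, ToLeft) (Blank :: l, r)) (rewinding [::] l r).
Proof. by case: r => [|c r] //; apply: left_rewinding [::] _. Qed.

Lemma left_blanks k :
  tape_eq (act (Blank, ToLeft) (nseq k Blank, [::])) (rewinding [::] [::] [::]).
Proof.
have E : forall r, tape_eq (nseq k.-1 Blank, r) ([::], r).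
  by move=> r; apply: (tape_eq_nseql [::]).
apply: tape_eq_trans (tape_eq_nseqr [::] [:: Blank] 1).
by case: k E => [|k] E //; apply: E.
Qed.

(** * One complete round *)

Section FullRound.
Variable O : seq symbol -> seq symbol.
Local Notation steps := (runs (M := greedy_machine) O).

Variables (I : Type) (n t : nat) (ws : I -> seq (seq symbol)).
Hypothesis ws_ok : forall i, all word_ok (ws i).
Hypothesis size_ws : forall i, size (ws i) = n.

Lemma remaining_blank l s : Blank \notin remaining ws l s.
Proof.
elim: l => //= i l IHl; rewrite /remaining /= mem_cat negb_or.
by rewrite remaining_row_blank.
Qed.

Lemma query_blank l s : Blank \notin query ws l s.
Proof.
elim: l => //= i l IHl; rewrite /query /= mem_cat negb_or.
by rewrite query_row_blank.
Qed.

Lemma output_blank (l : seq I) s : Blank \notin output n l s.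
Proof.
elim: l => //= i l IHl; rewrite /output /= mem_cat negb_or.
by rewrite blank_output_row.
Qed.

Lemma minus_output (l : seq I) s :
  (Minus \in output n l s) = has (fun i => size (s i) < n) l.
Proof.
by elim: l => //= i l IHl; rewrite /output /= mem_cat minus_output_row -IHl.
Qed.

Lemma size_output l s : (forall i, size (s i) <= n) ->
  size (output n l s) <= text_size ws l.
Proof.
move=> size_s; elim: l => // i l.
rewrite /text_size big_cons /output /= size_cat.
apply: leq_add; rewrite /output_row !size_cat size_bits size_slots /=.
by have := size_entries (ws_ok i); rewrite size_ws; have := size_s i; lia.
Qed.

Lemma size_query l s : (forall i, count id (s i) < n) ->
  size (query ws l s) <= text_size ws l.
Proof.
move=> count_s; elim: l => // i l.
rewrite /text_size big_cons /query /= size_cat.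
apply: leq_add.
have lt_s : count id (s i) < size (ws i) by rewrite size_ws.
have [p [e [rs [_ _ -> _ [_ ->]]]]] := row_split (ws_ok i) lt_s.
by rewrite size_cat /=; lia.
Qed.

Definition ready (q : phase) (f : bool) g l s : config greedy_machine :=
  conf q f (Blank :: g, output n l s) ([:: Blank], remaining ws l s)
    ([:: Blank], [::]).

Lemma round_runs f g l (s : I -> seq bool) (b : I -> bool) :
  (forall i, size (s i) = t) -> t < n ->
  O (query ws l s) = answer l b ->
  let s' i := rcons (s i) (b i) in
  let more := Minus \in output n l s' in
  steps (10 * text_size ws l + 5) (ready Build f g l s)
    (ready (if more then Build else Halt) more g l s').
Proof.
move=> size_s lt_t Oq s' more.
have count_s i : count id (s i) < n.
  by apply: leq_ltn_trans (count_size _ _) _; rewrite size_s.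
have size_s' i : size (s' i) <= n by rewrite size_rcons size_s.
set T := text_size ws l.
(* The terms are, in order: build, rewind, fill, rewind; the outer successor is the query itself. *)
apply: (@runs_le _ _ (3 * T + 1 + (T.+1 + (5 * T + 1 + T.+1).+1))).
  by lia.
apply: runs_trans; first exact: build_runs.
apply: runs_eql.
  apply: conf_eq; [exact: left_rewinding0 | exact: left_rewinding |].
  exact: left_rewinding.
apply: runs_trans.
  apply: (@rewind_runs _ _ (fun=> Ask) _ T) => //;
    rewrite ?mem_rev ?size_rev ?remaining_blank ?query_blank //.
  - by rewrite size_remaining.
  - exact: size_query.
rewrite !revK !cats0; apply: runsS.
rewrite step_ask word_blank_free ?query_blank // Oq.
apply: runs_trans; first by apply: (@fill_runs O _ n) => // i; rewrite size_s.
apply: runs_eql.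
  apply: conf_eq; [exact: left_rewinding | exact: left_rewinding |].
  by rewrite cats0; apply: left_blanks.
have := @rewind_runs O Rewind (fun h => if h then Build else Halt) false T
  (rev (output n l s')) (rev (remaining ws l s')) [::]
  g [::] [::] [::] [::] [::].
rewrite !revK !cats0 !size_rev !mem_rev orFb; apply => //.
- exact: output_blank.
- exact: remaining_blank.
- exact: size_output.
- by rewrite size_remaining.
Qed.

End FullRound.

Lemma minus_slots r : (Minus \in flatten (map slot r)) = (Comma \in r).
Proof. by elim: r => //= c r IHr; rewrite mem_cat IHr inE; case: c. Qed.

Lemma slots_entries ws : all word_ok ws ->
  flatten (map slot (entries ws)) = slots (size ws).
Proof.
elim: ws => //= e ws IHws /andP[/andP[_ de] /IHws E].
rewrite -[slots _]/[:: Minus, Comma & slots (size ws)] -E.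
rewrite /entries /= map_cat flatten_cat map_rcons flatten_rcons.
suff -> : flatten (map slot e) = [::] by [].
by elim: e de => //= -[] e IHe //= /IHe.
Qed.

(** * From the input to the halting configuration *)

Section Loop.
Variable O : seq symbol -> seq symbol.
Local Notation steps := (runs (M := greedy_machine) O).

Variables (I : Type) (n : nat) (ws : I -> seq (seq symbol)) (l : seq I).
Hypothesis ws_ok : forall i, all word_ok (ws i).
Hypothesis size_ws : forall i, size (ws i) = n.

Local Notation next s := (if Minus \in output n l s then Build else Halt).

Lemma init_runs : exists g,
  steps (3 * text_size ws l + 2)
    (start greedy_machine (remaining ws l (fun=> [::])))
    (ready n ws (next (fun=> [::])) false g l (fun=> [::])).
Proof.
set A := remaining _ _ _; set B := output _ _ _.
have BE : flatten (map slot A) = B.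
  rewrite /A /B; elim: l => // i l' IHl.
  rewrite /remaining /output /= map_cat flatten_cat -/(remaining _ _ _) IHl.
  congr (_ ++ _); rewrite /remaining_row /output_row /= take0 drop0 /=.
  by rewrite map_cat flatten_cat slots_entries // size_ws subn0.
have nA : Blank \notin A by apply: remaining_blank.
have sA : size A = text_size ws l by apply: size_remaining.
have [g Hg] := template_runs O false (rev A, [::]) ([::], [::]) [:: Blank] nA.
exists g; apply: runs_eql.
  have E : config_eq (start greedy_machine A)
      (conf Copy false ([::], A) ([::], [::]) ([::], [::])).
    by split=> // i; rewrite !ffunE; case: i => [[|[|[|]]] ?].
  exact: E.
apply: (@runs_le _ _ (size A + 1 + (2 * size A + 1))); first by lia.
apply: runs_trans.
  by apply: copy_runs; apply/allP => c cA; apply: contra nA; case: c cA.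
rewrite cats0; apply: runs_eqr; last exact: Hg.
(* The flag of the template phase records a comma of the input, the flag of later rewinds a minus
   sign of the output; [minus_slots] reconciles them. *)
rewrite /= cats0 BE -minus_slots BE; apply: conf_eq => //.
  exact: (tape_eq_nseqr _ _ 1).
exact: tape_eq_sym (tape_eq_nseql [::] _ 1).
Qed.

(** The invariant [P] is abstract: it will carry the chosen columns and the approximation bound,
    about which the machine knows nothing. *)
Lemma loop_runs (P : nat -> (I -> seq bool) -> Prop) k t f g s :
  (forall s t, P t s -> t < n -> (forall i, size (s i) = t) ->
     exists2 b, O (query ws l s) = answer l b
              & P t.+1 (fun i => rcons (s i) (b i))) ->
  P t s -> (forall i, size (s i) = t) -> t + k = n ->
  exists f' s', [/\ P n s', forall i, size (s' i) = n
    & steps (k * (15 * text_size ws l)) (ready n ws (next s) f g l s)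
        (ready n ws Halt f' g l s')].
Proof.
move=> step_P; elim: k t f s => [|k IHk] t f s Ps size_s.
  rewrite addn0 => t_n; rewrite t_n in Ps size_s.
  exists f, s; split=> //.
  rewrite minus_output (eq_has (a2 := pred0)) ?has_pred0; first exact: runs0.
  by move=> i; rewrite size_s ltnn.
rewrite addnS => t_n; have lt_t : t < n by lia.
have [b Ob Pb] := step_P s t Ps lt_t size_s.
set s1 := fun i => rcons (s i) (b i) in Pb.
have size_s1 i : size (s1 i) = t.+1 by rewrite size_rcons size_s.
have IH h := IHk _ h s1 Pb size_s1 t_n.
have [more|] := boolP (Minus \in output n l s).
  have [f' [s' [Ps' size_s' H]]] := IH (Minus \in output n l s1).
  exists f', s'; split=> //; rewrite mulSn; apply: runs_trans H.
  apply: runs_le (round_runs ws_ok size_ws f g size_s lt_t Ob).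
  (* A minus sign on the output tape forces a row, so [text_size] is positive and absorbs the
     additive 5 of a round. *)
  suff: 0 < text_size ws l by lia.
  by move: more; case: (l) => // i l' _; rewrite /text_size big_cons.
(* No minus sign although [t < n]: there are no rows and the machine has already halted. The
   remaining rounds leave the tapes unchanged and take no time, but [P] must still be advanced to
   [n]. *)
rewrite minus_output (eq_has (a2 := predT)) ?has_predT; last first.
  by move=> i; rewrite size_s lt_t.
have [f' [s' [Ps' size_s' H]]] := IH f.
move=> l0; exists f', s'; split=> //; case: (l) l0 H => // _ H.
by apply: runs_le H; rewrite leq_mul2r leqnSn orbT.
Qed.

End Loop.

(** * The approximation guarantee *)

Local Open Scope ring_scope.

Lemma sort_bits (s : seq bool) :
  sort >=%R [seq (b : nat)%:Z | b : bool <- s] =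
  nseq (count id s) 1 ++ nseq (size s - count id s) 0.
Proof.
have getr : transitive (>=%R : rel int).
  by move=> a b c /= ab bc; apply: le_trans ab.
have geto : total (>=%R : rel int) by move=> a b; apply: (le_total b a).
have gean : antisymmetric (>=%R : rel int).
  by move=> a b /= ba; apply/eqP; rewrite eq_le andbC.
apply: (sorted_eq getr gean); first exact: sort_sorted.
  have sortn k (a : int) : sorted >=%R (nseq k a).
    by elim: k => //= k; case: k => //= k ->; rewrite lexx.
  move: (size s - _)%N => m; elim: (count id s) => [|k IHk]; first exact: sortn.
  rewrite /= (path_sortedE getr) IHk andbT all_cat !all_nseq.
  by apply/andP; split; apply/orP; right; [apply: lexx | apply: ler01].
rewrite perm_sort; elim: s => //= b s IHs; case: b => /=.
  by rewrite add1n subSS perm_cons.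
rewrite add0n subSn ?count_size //= perm_sym.
by rewrite -cat1s perm_catCA /= perm_cons perm_sym.
Qed.

Definition ones d n (y : 'M[bool]_(d, n)) (i : 'I_d) : nat :=
  count id [seq y i j | j <- enum 'I_n].

(** Columns are indexed by [nat], so that a count of ones serves as the index of the next column;
    from [n] on the entry is 0. *)
Definition entry d n (c : 'M[int]_(d, n)) (i : 'I_d) (k : nat) : int :=
  [seq c i j | j <- enum 'I_n]`_k.

Definition value d n (c : 'M[int]_(d, n)) (k : 'I_d -> nat) : int :=
  \sum_i \sum_(j < k i) entry c i j.

Lemma entryE d n (c : 'M[int]_(d, n)) i (j : 'I_n) : entry c i j = c i j.
Proof. by rewrite /entry (nth_map j) ?size_enum_ord ?nth_ord_enum. Qed.

Lemma ones_le d n (y : 'M[bool]_(d, n)) i : (ones y i <= n)%N.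
Proof.
by apply: leq_trans (count_size _ _) _; rewrite size_map size_enum_ord.
Qed.

(** Sorting a 0/1 row moves its ones to the front, so the objective depends only on the number of
    ones in each row. *)
Lemma pairing_shift d n (c : 'M[int]_(d, n)) y :
  pairing c (shift (mx01 y)) = value c (ones y).
Proof.
apply: eq_bigr => i _.
rewrite (big_ord_widen _ _ (ones_le y i)) [RHS]big_mkcond.
apply: eq_bigr => j _; rewrite entryE mxE.
have -> : [seq mx01 y i k | k <- enum 'I_n] =
    [seq (b : nat)%:Z | b : bool <- [seq y i k | k <- enum 'I_n]].
  by rewrite -map_comp; apply: eq_map => k; rewrite /= mxE.
rewrite sort_bits -/(ones y i) nth_cat size_nseq nth_nseq nth_nseq.
by case: ltnP => // _; rewrite ?mulr1 // if_same mulr0.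
Qed.

(** Past [k] each further term is at most [a k]; below [k] the missing terms are nonnegative. The
    slope is charged for all [m] ones instead of [m - k], which makes the bound linear in [m] and
    hence additive over the columns of a matrix. *)
Lemma sum_concave (n k m : nat) (a : nat -> int) :
  (forall i j, (i <= j < n)%N -> a j <= a i) ->
  (forall j, (j < k)%N -> 0 <= a j) ->
  (k < n)%N -> (m <= n)%N ->
  \sum_(j < m) a j <= \sum_(j < k) a j + Num.max (a k) 0 * m%:R.
Proof.
move=> mono_a pos_a ltkn; elim: m => [|m IHm] lemn.
  rewrite big_ord0 mulr0 addr0; apply: sumr_ge0 => j _; exact: pos_a.
have [lekm|ltmk] := leqP k m.
  rewrite big_ord_recr /= -natr1 mulrDr mulr1 addrA.
  apply: lerD; first by apply: IHm; apply: ltnW.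
  by apply: (@le_trans _ _ (a k)); rewrite ?le_max ?lexx // mono_a // lekm.
apply: (@le_trans _ _ (\sum_(j < k) a j)).
  rewrite (big_ord_widen _ _ ltmk) [leLHS]big_mkcond; apply: ler_sum => j _.
  by case: ifP => // _; apply: pos_a.
by rewrite lerDl mulr_ge0 ?ler0n // le_max lexx orbT.
Qed.

Section GreedyBound.
Variables (d n : nat) (c : 'M[int]_(d, n)) (S : {set 'cV[bool]_d}).
Hypothesis n_gt0 : (0 < n)%N.
Hypothesis c_noninc : row_nonincreasing c.
Hypothesis S_indep : independence_system S.

Implicit Types (k : 'I_d -> nat) (y z : 'cV[bool]_d).

Definition marginal k : 'cV[int]_d := \col_i entry c i (k i).

Definition add_column k y (i : 'I_d) : nat := (k i + y i 0%R)%N.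

Definition optimal_column (w : 'cV[int]_d) y : Prop :=
  y \in S /\ forall z, z \in S -> pairing w (mx01 z) <= pairing w (mx01 y).

Lemma pairing_col (w : 'cV[int]_d) y :
  pairing w (mx01 y) = \sum_i w i 0 * (y i 0 : nat)%:Z.
Proof. by apply: eq_bigr => i _; rewrite big_ord1 mxE. Qed.

(** Deleting [i] from [y] stays in [S] and would improve on [y] if its weight were negative. This
    keeps all entries counted so far nonnegative, as [sum_concave] requires. *)
Lemma optimal_nonneg w y i : optimal_column w y -> y i 0 -> 0 <= w i 0.
Proof.
case=> Sy opt_y yi; rewrite leNgt; apply/negP => wi.
pose u : 'cV[bool]_d := \col_j (y j 0 && (j != i)).
have Su : u \in S by apply: (S_indep.2 u y) => // j; rewrite mxE => /andP[].
have := opt_y u Su; rewrite leNgt => /negP[]; rewrite !pairing_col.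
rewrite (bigD1 i) //= [ltRHS](bigD1 i) //= mxE eqxx andbF yi mulr0 mulr1.
rewrite (eq_bigr (fun j => w j 0 * (u j 0 : nat)%:Z)) ?ltrD2r // => j ji.
by rewrite mxE ji andbT.
Qed.

(** Restricting [z] to the coordinates of nonnegative weight stays in [S], and [y] is at least as
    good as this restriction. *)
Lemma optimal_positive_part w y z : optimal_column w y -> z \in S ->
  \sum_i Num.max (w i 0) 0 * (z i 0 : nat)%:Z <= pairing w (mx01 y).
Proof.
case=> _ opt_y Sz; pose u : 'cV[bool]_d := \col_i (z i 0 && (0 <= w i 0)).
have Su : u \in S by apply: (S_indep.2 u z) => // j; rewrite mxE => /andP[].
apply: le_trans (opt_y u Su); rewrite pairing_col; apply: ler_sum => i _.
by rewrite mxE; case: (leP 0 (w i 0)) => _; rewrite ?andbT ?andbF ?mul0r ?mulr0.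
Qed.

Lemma value_add_column k y :
  value c (add_column k y) = value c k + pairing (marginal k) (mx01 y).
Proof.
rewrite pairing_col -big_split; apply: eq_bigr => i _.
rewrite mxE /add_column /=; case: (y i 0); last by rewrite addn0 mulr0 addr0.
by rewrite addn1 big_ord_recr mulr1.
Qed.

Lemma ones_sum (z : 'M[bool]_(d, n)) i :
  (ones z i)%:R = \sum_j (z i j : nat)%:R :> int.
Proof.
rewrite /ones -natr_sum -sum1_count big_map big_enum_cond /= big_mkcond /=.
by congr (_%:R); apply: eq_bigr => j _; case: (z i j).
Qed.

(* The positive part of the marginal gains is a common linearization of the
   concave row values; by downward closure its maximum over [S] is the maximum
   of the marginal gains themselves. *)
Lemma greedy_gain k y (z : 'M[bool]_(d, n)) :
  (forall i, k i < n)%N -> (forall i j, (j < k i)%N -> 0 <= entry c i j) ->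
  z \in power n S -> optimal_column (marginal k) y ->
  value c (ones z) <= value c k + n%:R * pairing (marginal k) (mx01 y).
Proof.
move=> lt_k pos_k; rewrite inE => /forallP Sz opt_y.
pose w i := Num.max (entry c i (k i)) 0.
apply: (@le_trans _ _ (value c k + \sum_i w i * (ones z i)%:R)).
  rewrite -big_split; apply: ler_sum => i _.
  apply: (@sum_concave n) => // [j j' /andP[lejj' lt]||]; last exact: ones_le.
    have lt' := leq_ltn_trans lejj' lt.
    rewrite -[j]/(nat_of_ord (Ordinal lt')) -[j']/(nat_of_ord (Ordinal lt)).
    by rewrite !entryE; apply: c_noninc.
  exact: pos_k.
rewrite lerD2l.
rewrite (eq_bigr (fun i => \sum_j w i * (z i j : nat)%:R)); last first.
  by move=> i _; rewrite ones_sum mulr_sumr.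
(* Summed column by column: each of the [n] columns of [z] lies in [S] and contributes at most the
   gain of [y]. *)
rewrite exchange_big /= -[X in X%:R * _]card_ord mulr_natl -sumr_const.
apply: ler_sum => j _; have := optimal_positive_part opt_y (Sz j).
by apply: le_trans; apply: ler_sum => i _; rewrite /w !mxE natz.
Qed.

(** For a competitor of value [V] and current value [F], the second part is [V - F <= (1 - 1/n)^t V]
    with denominators cleared, so that it lives in [int]. *)
Definition greedy_bound k t : Prop :=
  (forall i j, (j < k i)%N -> 0 <= entry c i j) /\
  forall z : 'M[bool]_(d, n), z \in power n S ->
    n%:R ^+ t * (value c (ones z) - value c k) <=
    n.-1%:R ^+ t * value c (ones z).

Lemma eq_greedy_bound k k' t :
  k =1 k' -> greedy_bound k t -> greedy_bound k' t.
Proof.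
move=> Ek [pos_k bound_k]; split=> [i j|z Sz].
  by rewrite -Ek; apply: pos_k.
have <- : value c k = value c k' by apply: eq_bigr => i _; rewrite Ek.
exact: bound_k.
Qed.

(** Here [a] is [n - 1], [F] the current value and [P] the gain; cancelling [a * (V - F)] on both
    sides leaves the hypothesis. *)
Lemma gain_step (a V F P : int) :
  V <= F + (a + 1) * P -> (a + 1) * (V - (F + P)) <= a * (V - F).
Proof. by move=> gain; lra. Qed.

Lemma greedy_bound_add k y t : (forall i, k i < n)%N ->
  greedy_bound k t -> optimal_column (marginal k) y ->
  greedy_bound (add_column k y) t.+1.
Proof.
move=> lt_k [pos_k bound_k] opt_y; split=> [i j|z Sz].
  rewrite /add_column; case yi: (y i 0); last by rewrite addn0; apply: pos_k.
  rewrite addn1 ltnS leq_eqVlt => /predU1P[->|]; last exact: pos_k.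
  by have := optimal_nonneg opt_y yi; rewrite mxE.
rewrite value_add_column.
have gain := greedy_gain lt_k pos_k Sz opt_y.
rewrite !exprSr -!mulrA.
(* The new column trades one factor [n] for [n - 1]; the invariant accounts for the other [t]
   factors. *)
apply: (@le_trans _ _ (n%:R ^+ t * (n.-1%:R * (value c (ones z) - value c k)))).
  rewrite ler_wpM2l ?exprn_ge0 ?ler0n //.
  have nE : n%:R = n.-1%:R + 1 :> int by rewrite natr1 prednK.
  by rewrite nE; apply: gain_step; rewrite -nE.
rewrite mulrCA [leRHS]mulrCA; apply: ler_wpM2l; rewrite ?ler0n //.
exact: bound_k.
Qed.

Lemma greedy_bound_beta k (R : realFieldType) : independence_system S ->
  greedy_bound k n -> beta R n * (optimum S c)%:~R <= (value c k)%:~R.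
Proof.
move=> [S0 _] [_ bound_k]; have [[z Sz <-] _] := optimum_max c S0.
have {bound_k Sz} := bound_k z Sz; rewrite pairing_shift.
rewrite -(ler_int R) !(rmorphM, rmorphXn, rmorphB) /= !rmorph_nat.
move: (_%:~R) (_%:~R) => V W; rewrite /beta.
have nR : n%:R != 0 :> R by rewrite pnatr_eq0 -lt0n.
have -> : n.-1%:R = n%:R * (1 - n%:R^-1) :> R.
  by rewrite mulrBr mulr1 divff // -[in RHS](prednK n_gt0) -natr1 addrK.
rewrite exprMn -mulrA ler_pM2l ?exprn_gt0 ?ltr0n //.
by rewrite mulrBl mul1r lerBlDl lerBlDr addrC.
Qed.

End GreedyBound.

(** * Numerical bounds on the ratio *)

Lemma beta_ge (R : realType) n : (0 < n)%N -> 1 - (expR 1)^-1 <= beta R n.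
Proof.
move=> n_gt0; rewrite lerD2l lerN2 -expRN.
have nR : n%:R != 0 :> R by rewrite pnatr_eq0 -lt0n.
have -> : expR (-1) = expR (- n%:R^-1) ^+ n :> R.
  by rewrite -expRM_natl mulrN mulfV.
(* The inequality [1 + x <= expR x] at [x = - 1/n], raised to the power [n]; its left side is
   nonnegative since [n >= 1]. *)
apply: lerXn2r; rewrite ?nnegrE ?expR_ge0 ?expR_ge1Dx //.
by rewrite subr_ge0 invf_le1 ?ltr0n // ler1n.
Qed.

Lemma expR1_ge (R : realType) k : \sum_(i < k) (i`!)%:R^-1 <= expR 1 :> R.
Proof.
rewrite /expR.
have -> : \sum_(i < k) (i`!)%:R^-1 = series (exp_coeff (1 : R)) k.
  rewrite /series /= big_mkord; apply: eq_bigr => i _.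
  by rewrite /exp_coeff /= expr1n mul1r.
apply: nondecreasing_cvgn_le; last exact: is_cvg_series_exp_coeff.
apply/nondecreasing_seqP => i; rewrite seriesSr lerDl.
by rewrite exp_coeff_ge0.
Qed.

Lemma one_sub_invE_ge (R : realType) : 6321 / 10 ^+ 4 <= 1 - (expR 1)^-1 :> R.
Proof.
(* Eight terms of the series give 2.71825, just above 1/0.3679, which is about 2.71813; seven terms
   fall short. *)
have := expR1_ge R 8; rewrite !big_ord_recr big_ord0 /= !factS fact0 !muln1.
move=> le_e; have e0 := expR_gt0 (1 : R).
have : (expR 1 : R)^-1 <= 3679 / 10 ^+ 4.
  rewrite -[leRHS]invrK lef_pV2 ?posrE ?invr_gt0 //.
    apply: le_trans le_e; lra.
  by lra.
lra.
Qed.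

(** * Encodings *)

Lemma word_ok_encode_int z : word_ok (encode_int z).
Proof.
have digits m : all digit (encode_nat m).
  by rewrite all_rev all_map; apply/allP => i _ /=; case: odd.
rewrite /word_ok /encode_int all_cat digits andbT.
have size_nat m : (0 < size (encode_nat m))%N.
  by rewrite size_rev size_map size_iota.
by rewrite -size_eq0 size_cat -lt0n addn_gt0 size_nat orbT; case: ifP.
Qed.

Definition entry_words d n (x : 'M[int]_(d, n)) (i : 'I_d) : seq (seq symbol) :=
  [seq encode_int (x i j) | j <- enum 'I_n].

Lemma entry_words_ok d n (x : 'M[int]_(d, n)) i : all word_ok (entry_words x i).
Proof. by rewrite all_map; apply/allP => j _; apply: word_ok_encode_int. Qed.

Lemma size_entry_words d n (x : 'M[int]_(d, n)) i : size (entry_words x i) = n.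
Proof. by rewrite size_map size_enum_ord. Qed.

Lemma encodeE d n (x : 'M[int]_(d, n)) :
  encode x = remaining (entry_words x) (enum 'I_d) (fun=> [::]).
Proof.
congr flatten; apply: eq_map => i.
rewrite /remaining_row take0 drop0 /= -cats1 /entries /entry_words -map_comp.
by [].
Qed.

Lemma encode_bool (b : bool) : encode_int (b : nat)%:Z = [:: bit b].
Proof. by case: b. Qed.

Lemma encode_col d (w : 'cV[int]_d) :
  encode w =
  flatten [seq encode_int (w i 0) ++ [:: Comma; Semicolon] | i <- enum 'I_d].
Proof.
congr flatten; apply: eq_map => i.
have -> : enum 'I_1 = [:: ord0].
  by apply: (inj_map val_inj); rewrite val_enum_ord.
by rewrite /= cats0 -cats1 -cats1 -catA.
Qed.

(** What the build phase copies is literally the encoding of the marginal gains; the counts below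
    [n] ensure that every row still has an entry to offer. *)
Lemma encode_marginal d n (c : 'M[int]_(d, n)) (s : 'I_d -> seq bool) :
  (forall i, count id (s i) < n)%N ->
  encode (marginal c (fun i => count id (s i))) =
  query (entry_words c) (enum 'I_d) s.
Proof.
move=> lt_s; rewrite encode_col; congr flatten; apply: eq_map => i.
rewrite /query_row mxE /entry /entry_words; congr (_ ++ _).
by rewrite !(nth_map (Ordinal (lt_s i))) -?enumT ?size_enum_ord ?lt_s.
Qed.

Lemma encode_answer d (y : 'cV[bool]_d) :
  encode (mx01 y) = answer (enum 'I_d) (fun i => y i 0).
Proof.
rewrite encode_col; congr flatten; apply: eq_map => i.
by rewrite mxE encode_bool.
Qed.

(** With [n] bits in each row no slot is left, so the output tape already holds the required
    encoding. *)
Lemma encode_output d n (y : 'M[bool]_(d, n)) :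
  encode (mx01 y) =
  output n (enum 'I_d) (fun i => [seq y i j | j <- enum 'I_n]).
Proof.
congr flatten; apply: eq_map => i; rewrite /output_row size_map size_enum_ord.
rewrite subnn -cats1 /bits -map_comp /=; congr (flatten _ ++ _).
by apply: eq_map => j; rewrite /= mxE encode_bool.
Qed.

Lemma ready_halts (O : seq symbol -> seq symbol) (I : Type) (n m : nat)
    (ws : I -> seq (seq symbol)) x f g l s :
  runs O m (start greedy_machine x) (ready n ws Halt f g l s) ->
  exists2 t, (t <= m)%N & halts_with greedy_machine O x (output n l s) t.
Proof.
case=> t le_tm; rewrite /halts_with => E; exists t => //; move: E.
rewrite /halts_with; case: (iter _ _ _) => q T [/= -> /(_ ord0)].
rewrite ffunE => /eq_word ->; split=> //.
by rewrite word_blank_free ?output_blank.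
Qed.

Lemma text_size_encode d n (c : 'M[int]_(d, n)) :
  text_size (entry_words c) (enum 'I_d) = size (encode c).
Proof.
by rewrite encodeE size_remaining.
Qed.

(** If there is a row, its [n] entries occupy cells of the input, so [n] is at most the input
    length; without rows the encoding is empty and both sides vanish. *)
Lemma rounds_le_size d n (c : 'M[int]_(d, n)) :
  (n * size (encode c) <= size (encode c) ^ 2)%N.
Proof.
rewrite -text_size_encode; case: (enum 'I_d) => [|i l].
  by rewrite /text_size big_nil muln0.
rewrite -mulnn leq_mul2r /text_size big_cons; apply/orP; right.
have := size_entries (entry_words_ok c i); rewrite size_entry_words; lia.
Qed.

(** * The machine and the guarantee combined *)

Lemma greedy_machine_correct d n (c : 'M[int]_(d, n)) (S : {set 'cV[bool]_d})
    (O : seq symbol -> seq symbol) :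
  (0 < n)%N -> shifted c ->
  independence_system S -> linear_optimization_oracle S O ->
  exists (y : 'M[bool]_(d, n)) (t : nat),
    [/\ (t <= 15 * size (encode c) ^ 2 + 3 * size (encode c) + 2)%N,
        halts_with greedy_machine O (encode c) (encode (mx01 y)) t,
        y \in power n S & greedy_bound c S (ones y) n].
Proof.
move=> n_gt0 c_sh S_ind O_opt.
have [_ c_noninc] := (shiftP c c).1 c_sh.
pose row (ys : seq 'cV[bool]_d) i := [seq y i 0 | y : 'cV[bool]_d <- ys].
(* The tapes store the answers by rows, while membership in [S] concerns columns: [ys] lists the
   columns, and [row] transposes them. *)
pose P t (s : 'I_d -> seq bool) := exists ys : seq 'cV[bool]_d,
  [/\ size ys = t, all (mem S) ys, forall i, s i = row ys i &
  greedy_bound c S (fun i => count id (s i)) t].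
have step_P s t : P t s -> (t < n)%N -> (forall i, size (s i) = t) ->
    exists2 b, O (query (entry_words c) (enum 'I_d) s) = answer (enum 'I_d) b
             & P t.+1 (fun i => rcons (s i) (b i)).
  move=> [ys [size_ys Sys s_ys bound_s]] lt_t size_s.
  have lt_s i : (count id (s i) < n)%N.
    by apply: leq_ltn_trans (count_size _ _) _; rewrite size_s.
  have [y [Sy opt_y Oy]] := O_opt (marginal c (fun i => count id (s i))).
  exists (fun i => y i 0).
    by rewrite -encode_marginal // Oy encode_answer.
  exists (rcons ys y); split.
  - by rewrite size_rcons size_ys.
  - by rewrite all_rcons Sys andbT.
  - by move=> i; rewrite /row map_rcons s_ys.
  have := greedy_bound_add n_gt0 c_noninc S_ind lt_s bound_s (conj Sy opt_y).
  apply: eq_greedy_bound => i.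
  by rewrite /add_column -cats1 count_cat /= addn0.
have P0 : P 0%N (fun=> [::]).
  exists [::]; split=> //; split=> [//|z _].
  have -> : value c (fun=> count id [::]) = 0.
    by rewrite /value big1 // => i _; rewrite big_ord0.
  by rewrite !expr0 !mul1r subr0.
have [g init] :=
  init_runs O (enum 'I_d) (entry_words_ok c) (size_entry_words c).
have [f [s [[ys [size_ys Sys s_ys bound_s]] size_s loop]]] :=
  loop_runs (entry_words_ok c) (size_entry_words c) false g step_P P0
    (fun=> erefl) (add0n n).
have := runs_trans init loop; rewrite -encodeE => /ready_halts[t le_t halts].
pose y : 'M[bool]_(d, n) := \matrix_(i, j) (nth (const_mx false) ys j) i 0.
have rowE i : [seq y i j | j <- enum 'I_n] = s i.
  rewrite s_ys /row; apply: (@eq_from_nth _ false).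
    by rewrite size_map size_enum_ord size_map size_ys.
  move=> j; rewrite size_map size_enum_ord => lt_j.
  rewrite (nth_map (Ordinal lt_j)) ?size_enum_ord // mxE.
  by rewrite nth_enum_ord // (nth_map (const_mx false)) ?size_ys.
exists y, t; split.
- apply: leq_trans le_t _; rewrite text_size_encode.
  have := rounds_le_size c; lia.
- have -> : encode (mx01 y) = output n (enum 'I_d) s => //.
  by rewrite encode_output; congr flatten; apply: eq_map => i; rewrite rowE.
- rewrite inE; apply/forallP => j.
  have -> : col j y = nth (const_mx false) ys j.
    by apply/matrixP => i k; rewrite !mxE ord1.
  by apply: (allP Sys); apply: mem_nth; rewrite size_ys.
- by apply: eq_greedy_bound bound_s => i; rewrite /ones rowE.
Qed.

Theorem theorem3p4 :
  (exists (M : oracle_machine) (p : {poly nat}),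
    forall (d n : nat) (c : 'M[int]_(d, n)) (S : {set 'cV[bool]_d})
           (O : seq symbol -> seq symbol),
      (0 < n)%N -> shifted c ->
      independence_system S -> linear_optimization_oracle S O ->
      exists (y : 'M[bool]_(d, n)) (t : nat),
        [/\ (t <= p.[size (encode c)])%N,
            halts_with M O (encode c) (encode (mx01 y)) t,
            y \in power n S
          & forall R : realType,
              beta R n * (optimum S c)%:~R
                <= (pairing c (shift (mx01 y)))%:~R :> R]) /\
  (forall (R : realType) (n : nat), (0 < n)%N ->
     1 - (expR 1)^-1 <= beta R n) /\
  (forall R : realType, 6321 / 10 ^+ 4 <= 1 - (expR 1)^-1 :> R).
Proof.
split; last by split=> [R n|R]; [apply: beta_ge | apply: one_sub_invE_ge].
exists greedy_machine, ((15%N)%:P * 'X^2 + (3%N)%:P * 'X + (2%N)%:P).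
move=> d n c S O n_gt0 c_sh S_ind O_opt.
have [y [t [le_t halts Sy bound]]] :=
  greedy_machine_correct n_gt0 c_sh S_ind O_opt.
exists y, t; split=> // [|R]; last first.
  by rewrite pairing_shift; apply: greedy_bound_beta bound.
by rewrite !(hornerD, hornerM, hornerC, hornerX, hornerXn); apply: le_t.
Qed.
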